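(* Let $N\ge 4$ and $d\ge 1$ be integers, let $m=(N-1)d^2+Nd+1$, and let $f:\mathbb{R}^{m}\to\mathbb{R}$ be the deep linear network training objective $$f(W_1,\ldots,W_N,b_1,\ldots,b_N)=\tfrac12\left[\eta_{\mathbf{0}}+\log(1+\exp(-\eta_{\mathbf{0}}))\right]+\tfrac12\log(1+\exp(-\eta_{\mathbf{s}_1})),$$ where the parameters are $W_1,\ldots,W_{N-1}\in\mathbb{R}^{d\times d}$, $W_N\in\mathbb{R}^{1\times d}$, $b_1,\ldots,b_{N-1}\in\mathbb{R}^d$, $b_N\in\mathbb{R}$ (identified with a vector in $\mathbb{R}^{m}$), and, for $z\in\mathbb{R}^d$, $$\eta_z=W_N(W_{N-1}(\cdots(W_2(W_1z+b_1)+b_2)\cdots)+b_{N-1})+b_N.$$ Then, for every $\rho\ge 0$, $\nabla f:\mathbb{R}^m\to\mathbb{R}^m$ is neither $\rho$-integrated Lipschitz continuous nor $\rho$-order Lipschitz continuous.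
   Context: $\mathbf{0}\in\mathbb{R}^d$ is the zero vector and $\mathbf{s}_1\in\mathbb{R}^d$ is the first standard basis vector. Norms on $\mathbb{R}^m$ are Euclidean, and $0^0=1$ by convention. A continuous function $D:\mathbb{R}^m\to\mathbb{R}^m$ is $\rho$-order Lipschitz continuous if there exist constants $C_0,C_1\ge 0$ and, for every $x\in\mathbb{R}^m$, there exists an open ball $B_x$ around $x$ (centered at $x$, of positive radius), such that $$\Vert D(x_1)-D(x_2)\Vert_2\le \left(C_0+C_1\Vert D(x)\Vert_2^{\rho}\right)\Vert x_1-x_2\Vert_2\quad\text{for all }x_1,x_2\in B_x.$$ The constants $C_0,C_1$ do not depend on $x$. $D$ is $\rho$-integrated Lipschitz continuous if there exist constants $C_0,C_1\ge 0$ such that for all $x_1,x_2\in\mathbb{R}^m$, $$\Vert D(x_1)-D(x_2)\Vert_2\le \left(C_0+C_1\int_0^1\Vert D(x_1+t(x_2-x_1))\Vert_2^{\rho}\,dt\right)\Vert x_1-x_2\Vert_2.$$ *)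

(* Defs.v *)
From HB Require Import structures.
From mathcomp Require Import all_boot all_order all_algebra.
From mathcomp Require Import all_classical all_reals all_analysis.
Set Implicit Arguments.
Unset Strict Implicit.
Unset Printing Implicit Defensive.
Import Order.TTheory GRing.Theory Num.Theory.
Import numFieldNormedType.Exports.
Local Open Scope classical_set_scope.
Local Open Scope ring_scope.

(* The library norm on ['rV[R]_m] is the sup norm, so the Euclidean norm has to
   be spelled out. *)
Definition enorm (R : realType) (m : nat) (x : 'rV[R]_m) : R :=
  Num.sqrt (\sum_(i < m) x ord0 i ^+ 2).

Definition grad (R : realType) (m : nat) (f : 'rV[R]_m -> R) (x : 'rV[R]_m) :
    'rV[R]_m :=
  \row_(i < m) 'D_(delta_mx ord0 i) f x.

(* Both predicates below are intended for continuous [D]; the exponent uses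
   [powR], for which [0 `^ 0 = 1]. *)
Definition order_lipschitz (R : realType) (m : nat) (rho : R)
    (D : 'rV[R]_m -> 'rV[R]_m) : Prop :=
  exists C0 C1 : R, [/\ 0 <= C0, 0 <= C1 &
    forall x : 'rV[R]_m, exists2 r : R, 0 < r &
      forall x1 x2 : 'rV[R]_m, enorm (x1 - x) < r -> enorm (x2 - x) < r ->
        enorm (D x1 - D x2) <= (C0 + C1 * enorm (D x) `^ rho) * enorm (x1 - x2)].

Definition integrated_lipschitz (R : realType) (m : nat) (rho : R)
    (D : 'rV[R]_m -> 'rV[R]_m) : Prop :=
  exists C0 C1 : R, [/\ 0 <= C0, 0 <= C1 &
    forall x1 x2 : 'rV[R]_m,
      enorm (D x1 - D x2) <=
        (C0 + C1 * \int[@lebesgue_measure R]_(t in `[0, 1])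
                     (enorm (D (x1 + t *: (x2 - x1))) `^ rho))
        * enorm (x1 - x2)].

(* The blocks of a parameter vector are, in order: [W_1, ..., W_(N-1)] (each
   flattened row by row), [W_N], [b_1, ..., b_(N-1)], [b_N]. *)
Definition nparams (N d : nat) : nat :=
  (N.-1 * (d * d) + (d + (N.-1 * d + 1)))%N.

Lemma nparamsE (N d : nat) : (0 < N)%N ->
  nparams N d = ((N - 1) * d ^ 2 + N * d + 1)%N.
Proof.
by case: N => // n _; rewrite /nparams subn1 /= -mulnn mulSn !addnA.
Qed.

(* [i : 'I_N.-1] stands for the layer number [i + 1]. *)
Definition hidden_weight (R : realType) (N d : nat)
    (w : 'rV[R]_(nparams N d)) (i : 'I_N.-1) : 'M[R]_(d, d) :=
  vec_mx (row i (vec_mx (lsubmx w))).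

Definition output_weight (R : realType) (N d : nat)
    (w : 'rV[R]_(nparams N d)) : 'rV[R]_d :=
  lsubmx (rsubmx w).

Definition hidden_bias (R : realType) (N d : nat)
    (w : 'rV[R]_(nparams N d)) (i : 'I_N.-1) : 'cV[R]_d :=
  (row i (vec_mx (lsubmx (rsubmx (rsubmx w)))))^T.

Definition output_bias (R : realType) (N d : nat)
    (w : 'rV[R]_(nparams N d)) : R :=
  (rsubmx (rsubmx (rsubmx w))) ord0 ord0.

(* [enum 'I_N.-1] is increasing, so [foldl] applies layer 1 first. *)
Definition last_hidden (R : realType) (N d : nat)
    (w : 'rV[R]_(nparams N d)) (z : 'cV[R]_d) : 'cV[R]_d :=
  foldl (fun a i => hidden_weight w i *m a + hidden_bias w i) z (enum 'I_N.-1).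

Definition eta (R : realType) (N d : nat)
    (w : 'rV[R]_(nparams N d)) (z : 'cV[R]_d) : R :=
  (output_weight w *m last_hidden w z) ord0 ord0 + output_bias w.

Definition std_basis1 (R : realType) (d : nat) : 'cV[R]_d :=
  \col_(i < d) ((i : nat) == 0%N)%:R.

Definition dln_objective (R : realType) (N d : nat)
    (w : 'rV[R]_(nparams N d)) : R :=
  2^-1 * (eta w 0 + ln (1 + expR (- eta w 0))) +
  2^-1 * ln (1 + expR (- eta w (std_basis1 R d))).

(* Main.v *)
(* Take all biases and W_N to be zero and the hidden layers to be scalar matrices
   k_i I. On this set both eta_0 and eta_(s_1) vanish, and the gradient of f is
   -(prod_i k_i) / 4 times the unit vector of the first entry of W_N. Fixing
   k_1 = c and moving k_(N-1) away from 0 thus leaves a critical point with the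
   gradient growing at a rate proportional to c, while the bound demanded by
   either Lipschitz condition stays independent of c. *)
Require Import Defs.
From mathcomp Require Import all_boot all_order all_algebra.
From mathcomp Require Import all_classical all_reals all_analysis.
From mathcomp Require Import measurable_realfun ring.
Import Order.TTheory GRing.Theory Num.Theory.
Import numFieldNormedType.Exports.
Local Open Scope ring_scope.

(** * Euclidean norm and one-variable calculus *)

Lemma enorm_ge0 (R : realType) (m : nat) (x : 'rV[R]_m) : 0 <= enorm x.
Proof. exact: sqrtr_ge0. Qed.

Lemma enormZ (R : realType) (m : nat) (a : R) (x : 'rV[R]_m) :
  enorm (a *: x) = `|a| * enorm x.
Proof.
rewrite /enorm -sqrtr_sqr -sqrtrM ?sqr_ge0// mulr_sumr; congr Num.sqrt.
by apply: eq_bigr => i _; rewrite mxE exprMn.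
Qed.

Lemma enorm_gt0 (R : realType) (m : nat) (x : 'rV[R]_m) (i : 'I_m) :
  x ord0 i != 0 -> 0 < enorm x.
Proof.
move=> xi; rewrite sqrtr_gt0 (bigD1 i)//= ltr_wpDr//.
  by apply: sumr_ge0 => j _; rewrite sqr_ge0.
by rewrite lt_neqAle sqr_ge0 andbT eq_sym sqrf_eq0.
Qed.

(** Reduces partial derivatives of the objective to one-variable calculus: only its restriction to
    coordinate lines has to be understood. *)
Lemma deriveE_line (R : realType) (V : normedModType R) (f : V -> R) (x v : V) :
  'D_v f x = (fun h : R => f (x + h *: v))^`()%classic 0.
Proof.
rewrite derive1E /derive; set p := (X in _ = lim (X @ _)%classic).
suff -> : p = (fun h => h^-1 *: ((f \o shift x) (h *: v) - f x)) by [].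
apply/funext => h; rewrite /p /= addr0 [h *: 1]mulr1 scale0r addr0.
by rewrite [x + _]addrC.
Qed.

(** On the segment used against the integrated condition, the gradient has norm exactly [t], so this
    is the integral that occurs there. *)
Lemma Rintegral_powR_le1 (R : realType) (rho : R) : 0 <= rho ->
  \int[@lebesgue_measure R]_(t in `[0, 1]%classic) (t `^ rho) <= 1.
Proof.
move=> rho0.
rewrite /Rintegral -[leRHS]/(fine (1%:E : \bar R)).
have le1 : (\int[@lebesgue_measure R]_(t in `[0%R, 1%R]%classic) (t `^ rho)%:E <= 1)%E.
  have -> : (1%E = \int[@lebesgue_measure R]_(t in `[0%R, 1%R]%classic) (cst 1%E t))%E.
    by rewrite integral_cst//= lebesgue_measure_itv/= lte_fin ltr01 sube0 mul1e.
  apply: ge0_le_integral => //.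
  - by move=> t _; rewrite lee_fin powR_ge0.
  - apply/measurable_EFinP; apply: measurable_funTS; exact: measurable_powR.
  - move=> t; rewrite /= in_itv/= => /andP[t0 t1]; rewrite lee_fin.
    by apply: (@le_trans _ _ (1 `^ rho)); [rewrite ge0_ler_powR// nnegrE|rewrite powR1].
(* Being nonnegative and at most 1, the integral is finite, so [fine] preserves the inequality. *)
have ge0 : (0 <= \int[@lebesgue_measure R]_(t in `[0%R, 1%R]%classic) (t `^ rho)%:E)%E.
  by apply: integral_ge0 => t _; rewrite lee_fin powR_ge0.
by apply: fine_le => //; rewrite ge0_fin_numE// (le_lt_trans le1)// ltry.
Qed.

Lemma is_derive_log1pexpN (R : realType) (a : R) :
  is_derive (0 : R) 1 (fun h : R => ln (1 + expR (- (h * a)))) (- a / 2).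
Proof.
have dg : is_derive (0 : R) 1 (fun h : R => 1 + expR (- (h * a))) (- a).
  apply: is_derive_eq; rewrite /= mul0r oppr0 expR0.
  by rewrite /GRing.scale/=; ring.
have dl : is_derive (1 + expR (- (0 * a))) 1 (@ln R) 2^-1.
  have := @is_derive1_ln R (1 + expR (- (0 * a))).
  by rewrite mul0r oppr0 expR0; apply; exact: addr_gt0.
rewrite mulrC.
exact: (@is_derive1_comp _ (@ln R) (fun h => 1 + expR (- (h * a))) _ _ _ dl dg).
Qed.

(** * The gradient at scalar points *)

Section Objective.
Context (R : realType) (N d : nat).
Local Notation param := ('rV[R]_(nparams N d)).

Lemma derive_dln_objective (w v : param) (a0 a1 : R) :
  (forall h, eta (w + h *: v) 0 = h * a0) ->
  (forall h, eta (w + h *: v) (std_basis1 R d) = h * a1) ->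
  'D_v (@dln_objective R N d) w = (a0 - a1) / 4.
Proof.
move=> e0 e1; rewrite deriveE_line.
under eq_fun do rewrite /dln_objective e0 e1.
rewrite derive1E.
have d0 := @is_derive_log1pexpN R a0.
have d1 := @is_derive_log1pexpN R a1.
apply: derive_val.
apply: is_derive_eq.
by rewrite /GRing.scale/=; field.
Qed.

Definition scalar_point (k : 'I_N.-1 -> R) : param :=
  row_mx (mxvec (\matrix_i mxvec (k i)%:M)) 0.

Definition grad_direction : param :=
  (- 4^-1) *: row_mx 0 (row_mx (std_basis1 R d)^T 0).

(** A zero output layer discards the hidden state, so perturbing hidden weights or biases cannot
    move [eta]. *)
Lemma eta_output_weight0 (w : param) (z : 'cV[R]_d) :
  output_weight w = 0 -> eta w z = output_bias w.
Proof. by move=> w0; rewrite /eta w0 mul0mx mxE add0r. Qed.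

Lemma last_hidden_scalar (k : 'I_N.-1 -> R) (w : param) (z : 'cV[R]_d) :
  (forall i, hidden_weight w i = (k i)%:M) ->
  (forall i, hidden_bias w i = 0) ->
  last_hidden w z = (\prod_i k i) *: z.
Proof.
(* The product is put over the list that [foldl] traverses, and [z] is generalized because it is the
   accumulator. *)
move=> wk wb; rewrite /last_hidden -[index_enum _]/(Finite.enum _) -enumT.
elim: (enum _) z => [|i s IH] z /=; first by rewrite big_nil scale1r.
by rewrite IH wk wb addr0 mul_scalar_mx scalerA big_cons mulrC.
Qed.

Lemma hidden_weightE (w : param) i j1 j2 :
  hidden_weight w i j1 j2 = w ord0 (lshift _ (mxvec_index i (mxvec_index j1 j2))).
Proof. by rewrite !mxE. Qed.

Lemma output_weightE (w : param) (j : 'I_d) :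
  output_weight w ord0 j = w ord0 (rshift _ (lshift _ j)).
Proof. by rewrite !mxE. Qed.

Lemma hidden_biasE (w : param) (i : 'I_N.-1) (j : 'I_d) :
  hidden_bias w i j ord0 = w ord0 (rshift _ (rshift _ (lshift _ (mxvec_index i j)))).
Proof. by rewrite !mxE. Qed.

Lemma output_biasE (w : param) :
  output_bias w = w ord0 (rshift _ (rshift _ (rshift _ ord0))).
Proof. by rewrite /output_bias !mxE. Qed.

Lemma scalar_pointEl (k : 'I_N.-1 -> R) i j1 j2 :
  scalar_point k ord0 (lshift _ (mxvec_index i (mxvec_index j1 j2))) =
  (k i)%:M j1 j2.
Proof. by rewrite /scalar_point row_mxEl mxvecE mxE mxvecE. Qed.

Lemma scalar_pointEr (k : 'I_N.-1 -> R) i :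
  scalar_point k ord0 (rshift (N.-1 * (d * d)) i) = 0.
Proof. by rewrite /scalar_point row_mxEr mxE. Qed.

Lemma grad_directionE (j : 'I_d) :
  grad_direction ord0 (rshift _ (lshift _ j)) = - 4^-1 * (j == 0%N :> nat)%:R.
Proof. by rewrite /grad_direction mxE row_mxEr row_mxEl !mxE. Qed.

Lemma shift_deltaE (w : param) (h : R) i j :
  (w + h *: delta_mx ord0 i) ord0 j = w ord0 j + h * (j == i)%:R.
Proof. by rewrite mxE [X in _ + X]mxE [X in h * X]mxE eqxx. Qed.

(** The coordinate is located in one of the four parameter blocks; along each coordinate line [eta]
    is linear in [h], so [derive_dln_objective] applies. *)
Lemma grad_scalar_point (k : 'I_N.-1 -> R) :
  grad (@dln_objective R N d) (scalar_point k) = (\prod_i k i) *: grad_direction.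
Proof.
pose shiftE := (hidden_weightE, output_weightE, hidden_biasE, output_biasE,
  shift_deltaE, scalar_pointEr, eq_lrshift, eq_rlshift, eq_rshift).
apply/rowP => i; rewrite mxE [RHS]mxE.
case: (split_ordP i) => {}i ->; last case: (split_ordP i) => {}i ->;
  last case: (split_ordP i) => {}i ->.
- have e z h : eta (scalar_point k + h *: delta_mx ord0 (lshift _ i)) z = h * 0.
    rewrite eta_output_weight0; first by rewrite !shiftE mulr0 addr0.
    by apply/rowP => j; rewrite !shiftE mulr0 addr0 mxE.
  rewrite (derive_dln_objective _ _ _ _ (e _) (e _)) subrr mul0r.
  by rewrite /grad_direction mxE row_mxEl mxE !mulr0.
(* Entry [i] of W_N reads off entry [i] of the last hidden vector. This vanishes for input 0, so
   only the first entry, with input s_1, contributes. *)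
- pose v : param := delta_mx ord0 (rshift _ (lshift _ i)).
  have e z h : eta (scalar_point k + h *: v) z = h * ((\prod_i k i) * z i ord0).
    rewrite /eta (@last_hidden_scalar k); first last.
    + by move=> l; apply/colP => j; rewrite !shiftE mulr0 addr0 mxE.
    + move=> l; apply/matrixP => j1 j2.
      by rewrite !shiftE scalar_pointEl mulr0 addr0.
    rewrite !shiftE mulr0 !addr0 mxE (bigD1 i)//= [X in _ + X]big1 => [|j ji].
      by rewrite !shiftE eq_lshift eqxx mulr1 add0r addr0 mxE.
    by rewrite !shiftE eq_lshift (negbTE ji) mulr0 addr0 mul0r.
  by rewrite (derive_dln_objective _ _ _ _ (e _) (e _)) grad_directionE !mxE; field.
- have e z h : eta (scalar_point k +
      h *: delta_mx ord0 (rshift _ (rshift _ (lshift _ i)))) z = h * 0.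
    rewrite eta_output_weight0; first by rewrite !shiftE mulr0 addr0.
    by apply/rowP => j; rewrite !shiftE mulr0 addr0 mxE.
  rewrite (derive_dln_objective _ _ _ _ (e _) (e _)) subrr mul0r.
  by rewrite /grad_direction mxE !row_mxEr mxE !mulr0.
(* The output bias shifts both values of [eta] equally, and the two contributions cancel. *)
- have e z h : eta (scalar_point k +
      h *: delta_mx ord0 (rshift _ (rshift _ (rshift _ i)))) z = h * 1.
    rewrite eta_output_weight0; first by rewrite !shiftE (ord1 i) eqxx add0r.
    by apply/rowP => j; rewrite !shiftE mulr0 addr0 mxE.
  rewrite (derive_dln_objective _ _ _ _ (e _) (e _)) subrr mul0r.
  by rewrite /grad_direction mxE !row_mxEr mxE !mulr0.
Qed.

Lemma enorm_grad_direction_gt0 : (0 < d)%N -> 0 < enorm grad_direction.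
Proof.
move=> d0; apply: (@enorm_gt0 _ _ _ (rshift _ (lshift _ (Ordinal d0)))).
by rewrite grad_directionE eqxx mulr1 oppr_eq0 invr_eq0 pnatr_eq0.
Qed.

End Objective.

(** * A line of scalar points with prescribed gradient growth *)

Lemma scalar_pointDZ (R : realType) (N d : nat) (k l : 'I_N.-1 -> R) (s : R) :
  scalar_point R N d (fun i => k i + s * l i) = scalar_point R N d k + s *: scalar_point R N d l.
Proof.
rewrite /scalar_point scale_row_mx add_row_mx scaler0 addr0; congr row_mx.
rewrite -linearZ -linearD; congr mxvec; apply/row_matrixP => i.
by rewrite linearD linearZ /= !rowK -linearZ -linearD /= scale_scalar_mx raddfD.
Qed.

(* It is essential that [u] does not depend on [c]. *)
Lemma critical_line (R : realType) (N d : nat) : (3 <= N)%N ->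
  exists u : 'rV[R]_(nparams N d), forall c : R, exists w, forall s : R,
    grad (@dln_objective R N d) (w + s *: u) = (s * c) *: grad_direction R N d.
Proof.
(* At least two hidden layers remain, so [ord0] and [ord_max] differ: one factor holds [c], the
   other carries [s]. *)
case: N => [|[|[|n]]]// _.
pose l (i : 'I_n.+2) : R := (i == ord_max)%:R.
exists (scalar_point R n.+3 d l) => c.
pose k (i : 'I_n.+2) : R := if i == ord_max then 0 else if i == ord0 then c else 1.
exists (scalar_point R n.+3 d k) => s.
rewrite -scalar_pointDZ grad_scalar_point; congr (_ *: _).
rewrite (bigD1 ord_max)//= (bigD1 ord0)//= big1 => [|i /andP[im i0]].
  by rewrite /k /l eqxx/= mulr0 addr0 !mulr1 add0r.
by rewrite /k /l (negbTE im) (negbTE i0) mulr0 addr0.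
Qed.

Theorem proposition9 (R : realType) (N d : nat) (hN : (4 <= N)%N) (hd : (1 <= d)%N)
    (rho : R) (hrho : 0 <= rho) :
  ~ integrated_lipschitz rho (grad (@dln_objective R N d)) /\
  ~ order_lipschitz rho (grad (@dln_objective R N d)).
Proof.
have [u line] := @critical_line R N d (ltnW hN).
have G0 := @enorm_grad_direction_gt0 R N d hd.
set G := enorm (grad_direction R N d) in G0.
have u0 := enorm_ge0 _ _ u.
(* [c] solves c * G = L * enorm u + 1, which is possible because [u] is fixed before [c]. *)
have steep (L : R) : 0 <= L -> exists c, 0 < c /\ L * enorm u < c * G.
  move=> L0; exists ((L * enorm u + 1) / G); split.
    by rewrite divr_gt0// ltr_wpDl// mulr_ge0.
  by rewrite divfK ?gt_eqF// ltrDl.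
(* The constant C0 + C1 serves both cases, since the factor multiplying C1 will be at most 1: the
   integral in the first, 0 to the power [rho] in the second. *)
split=> -[C0 [C1 [C0p C1p lip]]];
  have [c [c0 cG]] := steep (C0 + C1) (addr_ge0 C0p C1p);
  have [w gradw] := line c;
  have gradw0 : grad (@dln_objective R N d) w = 0
    by rewrite -[w]addr0 -[X in w + X](scale0r u) gradw mul0r scale0r.
(* This length makes the gradient at the far endpoint a vector of norm 1, whatever [c] is. *)
- pose s := (c * G)^-1.
  have s0 : 0 < s by rewrite invr_gt0 mulr_gt0.
  have scG : s * c * G = 1 by rewrite -mulrA mulVf// gt_eqF// mulr_gt0.
  have := lip w (w + s *: u).
  have -> : w - (w + s *: u) = - s *: u by rewrite opprD addrA subrr add0r scaleNr.
  rewrite gradw0 sub0r -scaleN1r enormZ normrN1 mul1r.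
  rewrite gradw enormZ [enorm (- s *: u)]enormZ normrN (gtr0_norm s0).
  rewrite gtr0_norm ?mulr_gt0// -/G scG.
  set I := Rintegral _ _ _.
  have I1 : I <= 1.
    apply: le_trans (@Rintegral_powR_le1 R rho hrho).
    rewrite le_eqVlt; apply/orP; left; apply/eqP; apply: eq_Rintegral.
    move=> t; rewrite inE/= in_itv/= => /andP[t0 _].
    rewrite [_ - w]addrAC subrr add0r scalerA gradw enormZ -/G -mulrA normrM.
    by rewrite (ger0_norm t0) gtr0_norm ?mulr_gt0// -mulrA scG mulr1.
  apply/negP; rewrite -ltNge.
  apply: (@le_lt_trans _ _ ((C0 + C1) * (s * enorm u))).
    by rewrite ler_wpM2r ?mulr_ge0 ?(ltW s0)// lerD2l -[leRHS]mulr1 ler_wpM2l.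
  by rewrite mulrCA -ltr_pdivlMl// mulr1 invrK.
- have [r r0] := lip w.
  have [s s0 sur] : exists2 s : R, 0 < s & s * enorm u < r.
    (* Adding 1 gives a positive denominator without having to show that [u] is nonzero. *)
    have u1 : 0 < enorm u + 1 by rewrite ltr_wpDl.
    exists (r / (enorm u + 1)); first by rewrite divr_gt0.
    by rewrite mulrAC ltr_pdivrMr// ltr_pM2l// ltrDl.
  move=> /(_ (w + s *: u) w).
  rewrite subrr -[w + _ - w]addrAC subrr add0r -(scale0r u) !enormZ normr0 mul0r.
  rewrite gtr0_norm// gradw0 subr0 gradw enormZ -/G gtr0_norm ?mulr_gt0//.
  move=> /(_ sur r0); apply/negP; rewrite -ltNge.
  have -> : enorm (0 : 'rV[R]_(nparams N d)) = 0.
    by rewrite -(scale0r (0 : 'rV[R]_(nparams N d))) enormZ normr0 mul0r.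
  (* The power is 1 for [rho] = 0 and 0 otherwise. *)
  have p1 : (0 : R) `^ rho <= 1 by rewrite /powR eqxx lern1 leq_b1.
  apply: (@le_lt_trans _ _ ((C0 + C1) * (s * enorm u))).
    by rewrite ler_wpM2r ?mulr_ge0 ?(ltW s0)// lerD2l -[leRHS]mulr1 ler_wpM2l.
  by rewrite mulrCA -mulrA ltr_pM2l.
Qed.
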